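(* Let $(N,\nu)$ be the Cobb--Douglas production game, i.e. the TU game with characteristic function $$\nu(S)=\max_{x\ge0}\Big\{\prod_{j=1}^d x_j^{\lambda_j}:\ \mathcal{A}x=b(S)\Big\},\qquad b(S)=\sum_{i\in S}b(i),\quad S\subseteq N.$$ Then $(N,\nu)$ is a conic production game.
   Context: $N$ is a finite set of agents; $b:N\to\mathbb{R}^m$ assigns to each agent a bundle of $m$ resources; $\mathcal{A}:\mathbb{R}^d\to\mathbb{R}^m$ is linear; $\lambda_j\ge0$ for $j=1,\dots,d$ with $\sum_{j=1}^d\lambda_j=1$ (elasticities). Here ''max'' denotes the optimal value. A game $(N,\nu)$ is a conic production game if there are a finite-dimensional real vector space $V$, a proper cone $\mathcal{K}\subset V$ (pointed, closed, convex, nonempty interior), a linear functional $p\in V^*$, a linear map $\mathcal{A}':V\to\mathbb{R}^m$ and $b:N\to\mathbb{R}^m$ such that for every $S\subseteq N$, $\nu(S)=\max\{\langle p,x\rangle:\mathcal{A}'x=b(S),\ x\in\mathcal{K}\}$ with $b(S)=\sum_{i\in S}b(i)$. *)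

(* Defs.v *)
From HB Require Import structures.
From mathcomp Require Import all_boot all_order all_algebra.
From mathcomp Require Import all_classical all_reals all_analysis.

Set Implicit Arguments.
Unset Strict Implicit.
Unset Printing Implicit Defensive.

Import Order.TTheory GRing.Theory Num.Theory.
Import numFieldNormedType.Exports.

Local Open Scope classical_set_scope.
Local Open Scope ring_scope.

(* The usual convention: -oo if [D] is empty, +oo if [f] is unbounded above on
   [D]; attainment is not required. *)
Definition optimal_value (R : realType) (T : Type) (f : T -> R) (D : set T) :
  \bar R := ereal_sup [set (f x)%:E | x in D].

(* Characteristic functions are optimal values, hence take values in [\bar R].
   An ordinary TU game [v : {set N} -> R] is the finite-valued case
   [fun S => (v S)%:E]. *)
Definition game (R : realType) (N : finType) := {set N} -> \bar R.

Definition coalition_bundle (R : realType) (N : finType) (m : nat)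
  (b : N -> 'cV[R]_m) (S : {set N}) : 'cV[R]_m := \sum_(i in S) b i.

(* [powR 0 0 = 1], so a factor with exponent 0 is always 1. *)
Definition cobb_douglas (R : realType) (d : nat) (lambda : 'I_d -> R)
  (x : 'cV[R]_d) : R := \prod_(j < d) powR (x j ord0) (lambda j).

Definition cobb_douglas_production_game (R : realType) (N : finType)
    (m d : nat) (A : {linear 'cV[R]_d -> 'cV[R]_m}) (b : N -> 'cV[R]_m)
    (lambda : 'I_d -> R) : game R N :=
  fun S => optimal_value (cobb_douglas lambda)
    [set x : 'cV[R]_d | (forall j, 0 <= x j ord0) /\
                        A x = coalition_bundle b S].

Definition finite_dimensional (R : realType) (V : lmodType R) : Prop :=
  exists (n : nat) (e : 'I_n -> V),
    forall v : V, exists c : 'I_n -> R, v = \sum_(i < n) c i *: e i.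

Record proper_cone (R : realType) (V : normedModType R) (K : set V) : Prop :=
  ProperCone {
    proper_cone_scale : forall (a : R) (x : V), 0 <= a -> K x -> K (a *: x);
    proper_cone_convex : convex_set (K : set (convex_lmodType V));
    proper_cone_closed : closed K;
    proper_cone_pointed : forall x : V, K x -> K (- x) -> x = 0;
    proper_cone_interior : interior K !=set0
  }.

(* Closedness and interior refer to the canonical topology of the
   finite-dimensional space [V]: all norms on it induce the same one. *)
Definition conic_production_game (R : realType) (N : finType) (m : nat)
    (nu : game R N) : Prop :=
  exists V : normedModType R, finite_dimensional V /\
  exists (K : set V) (p : {linear V -> R^o}) (A : {linear V -> 'cV[R]_m})
         (b : N -> 'cV[R]_m),
    proper_cone K /\
    forall S : {set N},
      nu S = optimal_value p [set x : V | A x = coalition_bundle b S /\ K x].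

(* Main.v *)
Require Import Defs.
From HB Require Import structures.
From mathcomp Require Import all_boot all_order all_algebra.
From mathcomp Require Import all_classical all_reals all_analysis.

Set Implicit Arguments.
Unset Strict Implicit.
Unset Printing Implicit Defensive.

Import Order.TTheory GRing.Theory Num.Theory.
Import numFieldNormedType.Exports.
Local Open Scope ring_scope.

(** The conic form is the hypograph trick: maximizing the Cobb-Douglas function
    [CD] over [{x >= 0 | A x = b S}] is the same as maximizing the linear
    functional [(x, t) |-> t] over the points of the generalized power cone
      [K = {(x, t) | x >= 0, `|t| <= CD x}]
    that satisfy [A x = b S]; the bundles [b] do not change.  What has to be
    checked is that [K] is a proper cone in [R^d * R].
    Stability under nonnegative scaling is the homogeneity of [CD]
    ([cobb_douglasZ]), and convexity then follows from superadditivity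
    ([cobb_douglas_superadditive]).  The latter rests on the weighted
    arithmetic-geometric mean inequality ([cobb_douglas_le_mean]): for
    [z = x + y], one has [CD x = CD (x / z) * CD z] (componentwise quotient),
    and [CD (x / z) + CD (y / z)] is at most the weighted mean of
    [(x + y) / z], hence at most 1.  Closedness comes from the continuity of
    [a |-> `|a| `^ p] for [p >= 0], and the point [(1, ..., 1; 0)] is
    interior. *)

Section CobbDouglasInequalities.
Variables (R : realType) (d : nat) (lambda : 'I_d -> R).
Hypothesis lambda_ge0 : forall j, 0 <= lambda j.
Hypothesis lambda_sum : \sum_(j < d) lambda j = 1.
Implicit Types (x y z : 'cV[R]_d) (c : R).

Lemma lambda_neq0 : exists j, lambda j != 0.
Proof.
apply/existsP; rewrite -[X in is_true X]negbK negb_exists; apply/negP => /forallP l0.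
have /eqP := lambda_sum; rewrite big1 ?(eq_sym 0) ?oner_eq0// => j _.
by have := l0 j; rewrite negbK => /eqP.
Qed.

Lemma cobb_douglas_ge0 x : 0 <= cobb_douglas lambda x.
Proof. by apply: prodr_ge0 => j _; exact: powR_ge0. Qed.

Lemma cobb_douglas_le x y : (forall j, 0 <= x j ord0) ->
  (forall j, x j ord0 <= y j ord0) -> cobb_douglas lambda x <= cobb_douglas lambda y.
Proof.
move=> x0 xy; apply: ler_prod => j _; rewrite powR_ge0/=.
by apply: ge0_ler_powR; rewrite ?nnegrE// (le_trans (x0 j)).
Qed.

Lemma cobb_douglasM x y z : (forall j, 0 <= x j ord0) ->
  (forall j, 0 <= y j ord0) -> (forall j, z j ord0 = x j ord0 * y j ord0) ->
  cobb_douglas lambda z = cobb_douglas lambda x * cobb_douglas lambda y.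
Proof.
move=> x0 y0 zE; rewrite -big_split/=; apply: eq_bigr => j _.
by rewrite zE powRM.
Qed.

Lemma prod_expR (s : 'I_d -> R) :
  \prod_(j < d) expR (s j) = expR (\sum_(j < d) s j).
Proof. by rewrite (big_morph expR (@expRD R) (expR0 _)). Qed.

(** Homogeneity at the all-ones vector; this is where [lambda] summing to 1 is
    needed.  At [c = 0] the product vanishes because some [lambda j] is nonzero,
    whereas a factor with [lambda j = 0] equals 1. *)
Lemma cobb_douglas_const c : 0 <= c -> cobb_douglas lambda (const_mx c) = c.
Proof.
rewrite le_eqVlt => /predU1P[<-|c0].
  have [j lj] := lambda_neq0.
  by rewrite /cobb_douglas (bigD1 j)//= mxE powR0// mul0r.
rewrite /cobb_douglas (eq_bigr (fun j => expR (lambda j * ln c))); last first.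
  by move=> j _; rewrite mxE /powR gt_eqF.
by rewrite prod_expR -mulr_suml lambda_sum mul1r lnK.
Qed.

Lemma cobb_douglasZ c x : 0 <= c -> (forall j, 0 <= x j ord0) ->
  cobb_douglas lambda (c *: x) = c * cobb_douglas lambda x.
Proof.
move=> c0 x0; rewrite -[X in _ = X * _]cobb_douglas_const//.
by apply: cobb_douglasM => // j; rewrite !mxE.
Qed.

(** Weighted arithmetic-geometric mean inequality.  If the mean [s] is
    positive, then [1 + u <= expR u] gives
    [(x j / s) `^ lambda j <= expR (lambda j * (x j / s - 1))], and these
    exponents add up to 0; hence [CD (x / s) <= 1]. *)
Lemma cobb_douglas_le_mean x : (forall j, 0 <= x j ord0) ->
  cobb_douglas lambda x <= \sum_(j < d) lambda j * x j ord0.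
Proof.
move=> x0; set s := \sum_(j < d) _.
have t0 j : 0 <= lambda j * x j ord0 by rewrite mulr_ge0.
have : 0 <= s by exact: sumr_ge0.
rewrite le_eqVlt => /predU1P[s0|s_gt0]; last first.
  have -> : x = s *: (s^-1 *: x) by rewrite scalerA divff ?scale1r// gt_eqF.
  have xs0 j : 0 <= (s^-1 *: x) j ord0 by rewrite mxE mulr_ge0// invr_ge0 ltW.
  rewrite cobb_douglasZ ?(ltW s_gt0)// ger_pMr//.
  rewrite -expR0 -[X in expR X](_ : \sum_(j < d) lambda j * (s^-1 * x j ord0 - 1) = 0).
    rewrite -prod_expR; apply: ler_prod => j _; rewrite powR_ge0/=.
    rewrite mulrC expRM; apply: ge0_ler_powR; rewrite ?nnegrE ?expR_ge0//.
    by rewrite mxE; apply: le_trans (expR_ge1Dx _); rewrite addrC subrK.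
  under eq_bigr do rewrite mulrBr mulr1 mulrCA.
  by rewrite sumrB -mulr_sumr lambda_sum mulVf ?subrr// gt_eqF.
(* If the mean vanishes, then so does some [x j] with [lambda j != 0]. *)
have /eqP := esym s0; rewrite psumr_eq0// => /allP lx0.
have [j lj] := lambda_neq0.
have := lx0 j (mem_index_enum _); rewrite mulf_eq0 (negbTE lj)/= => /eqP xj.
by rewrite /cobb_douglas (bigD1 j)//= xj powR0// mul0r -s0.
Qed.

Lemma cobb_douglas_superadditive x y :
  (forall j, 0 <= x j ord0) -> (forall j, 0 <= y j ord0) ->
  cobb_douglas lambda x + cobb_douglas lambda y <= cobb_douglas lambda (x + y).
Proof.
move=> x0 y0.
have z0 j : 0 <= (x + y) j ord0 by rewrite mxE addr_ge0.
(* [q u] is the quotient [u / (x + y)].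
   Where the denominator vanishes, so do both [x] and [y], and the value of
   the quotient is immaterial. *)
pose q (u : 'cV[R]_d) : 'cV[R]_d := \col_j (u j ord0 / (x + y) j ord0).
have q0 (u : 'cV[R]_d) : (forall j, 0 <= u j ord0) -> forall j, 0 <= q u j ord0.
  by move=> u0 j; rewrite mxE divr_ge0.
have qK (u : 'cV[R]_d) : (forall j, 0 <= u j ord0 <= (x + y) j ord0) ->
    cobb_douglas lambda u = cobb_douglas lambda (q u) * cobb_douglas lambda (x + y).
  move=> u0; apply: cobb_douglasM => // j.
    by apply: q0 => i; case/andP: (u0 i).
  rewrite [q u _ _]mxE; have [zj|zj] := eqVneq ((x + y) j ord0) 0.
    rewrite zj mulr0; apply/eqP; rewrite eq_le andbC.
    by have := u0 j; rewrite zj.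
  by rewrite divfK.
rewrite (qK x); last by move=> j; rewrite x0 mxE lerDl y0.
rewrite (qK y); last by move=> j; rewrite y0 mxE lerDr x0.
rewrite -mulrDl ler_piMl ?cobb_douglas_ge0//.
apply: (le_trans (lerD (cobb_douglas_le_mean (q0 _ x0))
                       (cobb_douglas_le_mean (q0 _ y0)))).
rewrite -big_split -lambda_sum; apply: ler_sum => j _ /=.
rewrite -mulrDr ler_piMr// !mxE -mulrDl.
by have [->|z_neq0] := eqVneq (x j ord0 + y j ord0) 0; rewrite ?mul0r ?divff.
Qed.

End CobbDouglasInequalities.

(** The absolute value matters: [powR] is constantly 1 on negative numbers, so
    that [a |-> a `^ p] is discontinuous at 0 for [0 < p]. *)
Lemma continuous_powR_normr (R : realType) (p : R) : 0 <= p ->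
  continuous (fun a : R => `|a| `^ p).
Proof.
rewrite le_eqVlt => /predU1P[<- a|p0 a].
  under eq_fun do rewrite powRr0.
  exact: cvg_cst.
have [->|a0] := eqVneq a 0.
  apply/cvgrPdist_lt => e e0; near=> x.
  rewrite normr0 powR0 ?gt_eqF// sub0r normrN ger0_norm ?powR_ge0//.
  have -> : e = (e `^ p^-1) `^ p by rewrite -powRrM mulVf ?gt_eqF// powRr1 ?ltW.
  apply: gt0_ltr_powR; rewrite ?nnegrE ?powR_ge0//.
  near: x; apply/nbhs_ballP; exists (e `^ p^-1) => /=; first exact: powR_gt0.
  by move=> x; rewrite /ball/= sub0r normrN.
apply: (@continuous_comp _ _ _ (fun x : R => `|x|) (fun x => x `^ p)).
  exact: norm_continuous.
apply/differentiable_continuous/derivable1_diffP/derivable_powR.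
by rewrite in_itv/= normr_gt0 a0.
Unshelve. all: by end_near. Qed.

(** The generalized power cone [{(x, t) | x >= 0, `|t| <= CD x}]. *)
Definition power_cone (R : realType) (d : nat) (lambda : 'I_d -> R) :
    set ('cV[R]_d * R^o) :=
  [set v : 'cV[R]_d * R^o | (forall j, 0 <= v.1 j ord0) /\
    `|v.2| <= cobb_douglas lambda v.1]%classic.

Section PowerCone.
Variables (R : realType) (d : nat) (lambda : 'I_d -> R).
Hypothesis lambda_ge0 : forall j, 0 <= lambda j.
Hypothesis lambda_sum : \sum_(j < d) lambda j = 1.
Let V := ('cV[R]_d * R^o)%type.
Let K : set V := power_cone lambda.

Lemma power_coneZ (c : R) (v : V) : 0 <= c -> K v -> K (c *: v).
Proof.
move=> c0 [v0 tv]; split => [j|/=]; first by rewrite mxE mulr_ge0.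
by rewrite normrZ ger0_norm// cobb_douglasZ// ler_wpM2l.
Qed.

Lemma power_coneD (v w : V) : K v -> K w -> K (v + w).
Proof.
move=> [v0 tv] [w0 tw]; split => [j|/=]; first by rewrite mxE addr_ge0.
apply: le_trans (ler_normD _ _) (le_trans (lerD tv tw) _).
exact: cobb_douglas_superadditive.
Qed.

Lemma power_cone_convex : convex_set (K : set (convex_lmodType V)).
Proof.
move=> v w c; rewrite !inE => Kv Kw.
by apply: power_coneD; apply: power_coneZ => //; rewrite subr_ge0.
Qed.

Lemma power_cone_pointed (v : V) : K v -> K (- v) -> v = 0.
Proof.
move=> [v0 tv] [nv0 _].
have x0 : v.1 = 0.
  apply/matrixP => i j; rewrite ord1 mxE; apply/eqP.
  by rewrite eq_le v0 andbT -oppr_ge0; have := nv0 i; rewrite mxE.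
case: v x0 {v0 nv0} tv => x t /= ->; rewrite -[0]/(const_mx 0).
by rewrite cobb_douglas_const// normr_le0 => /eqP ->.
Qed.

Lemma power_cone_closed : closed K.
Proof.
have coord j : continuous (fun v : V => v.1 j ord0).
  move=> v; apply: (@continuous_comp _ _ _ fst (fun x : 'cV[R]_d => x j ord0)).
    exact: cvg_fst.
  exact: coord_continuous.
have normE (v : V) : (forall j, 0 <= v.1 j ord0) ->
    cobb_douglas lambda v.1 = \prod_(j < d) (`|v.1 j ord0| `^ lambda j).
  by move=> v0; apply: eq_bigr => j _; rewrite ger0_norm.
(* On the orthant the coordinates may be replaced by their absolute values,
   which makes the defining inequality continuous on the whole space. *)
have -> : K = ((\bigcap_j [set v : V | 0 <= v.1 j ord0]) `&`
    [set v : V | (0 : R) <=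
       \prod_(j < d) (`|v.1 j ord0| `^ lambda j) - `|v.2|])%classic.
  apply/seteqP; split => v [v0] vt; split.
  - by move=> j _; exact: v0.
  - by rewrite /= subr_ge0 -normE.
  - by move=> j; exact: v0.
  - by move: vt; rewrite /= subr_ge0 -normE// => j; exact: v0.
apply: closedI.
  apply: closed_bigI => j _.
  apply: (@preimage_closed _ _ (fun v : V => v.1 j ord0) [set a : R | 0 <= a]%classic).
    by move=> v _; exact: coord.
  exact: closed_ge.
apply: (@preimage_closed _ _
  (fun v : V => \prod_(j < d) (`|v.1 j ord0| `^ lambda j) - `|v.2| : R)
  [set a : R | 0 <= a]%classic); last exact: closed_ge.
move=> v _; apply: (@cvgB _ R^o); last by apply: cvg_norm; exact: cvg_snd.
apply: cvg_big => [|j _]; first exact: mul_continuous.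
apply: (@continuous_comp _ _ _ (fun v : V => v.1 j ord0)
                               (fun a : R => `|a| `^ lambda j)).
  exact: coord.
exact: continuous_powR_normr.
Qed.

Lemma power_cone_interior : (interior K !=set0)%classic.
Proof.
exists (const_mx 1, 0); apply/nbhs_ballP; exists 2^-1 => //= -[x t] [[_ xb] tb].
have xj j : 2^-1 <= x j ord0.
  have := xb j ord0; rewrite mxE /ball/= ltr_distlC => /andP[/ltW + _].
  by rewrite [X in X - _](splitr 1) mul1r addrK.
split => [j|/=]; first by apply: le_trans (xj j).
(* Monotonicity: [`|t| <= 1/2 = CD (1/2, ..., 1/2) <= CD x]. *)
move: tb; rewrite /ball/= sub0r normrN => /ltW /le_trans; apply.
rewrite -[X in X <= _](@cobb_douglas_const R d lambda)//.
by apply: cobb_douglas_le => // j; rewrite mxE.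
Qed.

Lemma power_cone_proper : proper_cone K.
Proof.
split.
- exact: power_coneZ.
- exact: power_cone_convex.
- exact: power_cone_closed.
- exact: power_cone_pointed.
- exact: power_cone_interior.
Qed.

End PowerCone.

Theorem proposition8 (R : realType) (N : finType) (m d : nat)
    (b : N -> 'cV[R]_m) (A : {linear 'cV[R]_d -> 'cV[R]_m})
    (lambda : 'I_d -> R)
    (lambda_ge0 : forall j, 0 <= lambda j)
    (lambda_sum : \sum_(j < d) lambda j = 1) :
  conic_production_game m (cobb_douglas_production_game A b lambda).
Proof.
exists ('cV[R]_d * R^o)%type; split.
  exists (\dim {: ('cV[R]_d * R^o)%type}).
  exists (fun i => (vbasis {: ('cV[R]_d * R^o)%type})`_i) => v.
  exists (fun i => coord (vbasis {: ('cV[R]_d * R^o)%type}) i v).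
  exact: coord_vbasis (memvf v).
exists (power_cone lambda), snd, (A \o fst), b.
split; first exact: power_cone_proper.
move=> S; apply/le_anti/andP; split; apply: ge_ereal_sup.
  move=> _ [x [x0 Ax] <-]; apply: ereal_sup_ubound.
  exists (x, cobb_douglas lambda x) => //; split => //; split => //=.
  by rewrite ger0_norm// cobb_douglas_ge0.
move=> _ [[x t] /= [Ax [x0 /= tx]] <-].
apply: (@le_trans _ _ (cobb_douglas lambda x)%:E).
  by rewrite lee_fin (le_trans (ler_norm t)).
by apply: ereal_sup_ubound; exists x.
Qed.
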